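(* Let $\mathcal I=\{I_m:m\ge1\}$. If $I_m\in\mathcal I$, then for every $\varepsilon>0$ and every potential function $\rho:V(I_m)\to\{3,4,6\}$ on $I_m$, $(I_m,\rho)$ is not $\varepsilon$-flexible.
   Context: Multigraphs are finite; they may have parallel edges but no loops. For $m\ge1$, $I_m$ is the multigraph obtained from a $(2m+1)$-cycle $v_1v_2\ldots v_{2m+1}v_1$ by duplicating the edge $v_{2i-1}v_{2i}$ for each $i\in\{1,\dots,m\}$. Covers. A DP $3$-cover $(H,L)$ of a multigraph $G$ is a graph $H$ together with pairwise disjoint sets $L(v)$, $v\in V(G)$, with union $V(H)$, such that each $L(v)$ is a clique of size $3$ in $H$, and for each pair $\{x,y\}$ of distinct vertices of $G$ joined by exactly $s\ge0$ edges, the set of edges of $H$ between $L(x)$ and $L(y)$ is the union of at most $s$ matchings. Each $L(v)$ is a pointed set: it comes with a distinguished basepoint $\omega(v)\in L(v)$, which is part of the data of the cover. If $L'(v)\subseteq L(v)$ for each $v$, an $(H,L')$-coloring of $G$ is a map $\varphi:V(G)\to V(H)$ with $\varphi(v)\in L'(v)$ for all $v$ and whose image is an independent set of $H$. Potential functions. A potential function is a map $\rho:V(G)\to\{3,4,6\}$. It defines $h_\rho(v)=2$ if $\rho(v)=3$ and $h_\rho(v)=3$ if $\rho(v)\in\{4,6\}$. List distributions. An $h_\rho$-list assignment assigns to each $v\in V(G)$ a set $L'(v)\subseteq L(v)$ of size $h_\rho(v)$. A list distribution $\mathcal D$ on $(G,\rho,H,L)$ is a probability distribution on $h_\rho$-list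 assignments; its random outcome is denoted $L_{\mathcal D}$. For a real $\varepsilon\in(0,1)$, it is $\varepsilon$-admissible if for each $v$ with $h_\rho(v)=2$ and each $c\in L(v)$, $\Pr(L(v)\setminus L_{\mathcal D}(v)=\{c\})\ge\varepsilon$. Coloring distributions. A coloring distribution $\Phi$ on $(G,\rho,H,L,\mathcal D)$ assigns to each outcome $L_{\mathcal D}$ of $\mathcal D$ a probability distribution on $(H,L_{\mathcal D})$-colorings of $G$; together with $\mathcal D$ it gives a joint distribution on pairs $(L_{\mathcal D},\phi)$ with first marginal $\mathcal D$ and with $\phi$ an $(H,L_{\mathcal D})$-coloring, and hence a random $(H,L)$-coloring $\phi$ of $G$. $\Phi$ is an $\varepsilon$-distribution if, with probabilities taken with respect to the overall joint distribution, for every $v\in V(G)$: (i) $\Pr(\phi(v)=c)\ge\varepsilon$ for each $c\in L(v)$; and (ii) if $\rho(v)=4$, then $\Pr(\phi(v)=\omega(v))=2\varepsilon$ and $\Pr(\phi(v)=c)=\frac12-\varepsilon$ for each $c\in L(v)\setminus\{\omega(v)\}$. Flexibility. $(G,\rho,H,L,\mathcal D)$ is $\varepsilon$-flexible if it has an $\varepsilon$-distribution. $(G,\rho)$ is $\varepsilon$-flexible if $(G,\rho,H,L,\mathcal D)$ is $\varepsilon$-flexible for every DP $3$-cover $(H,L)$ of $G$ (with every choice of basepoints) and every $\varepsilon$-admissible list distribution $\mathcal D$ on $(G,\rho,H,L)$.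
   Formalization: When ρ takes the value 3 somewhere, ε ≤ 1/3 is additionally assumed: for larger ε no ε-admissible list distribution exists, so (I_m, ρ) would be vacuously ε-flexible and the claim as stated fails. *)

(* Defs.v *)
From mathcomp Require Import all_boot all_order all_algebra.
From mathcomp Require Import reals.

Set Implicit Arguments.
Unset Strict Implicit.
Unset Printing Implicit Defensive.

Import Order.TTheory GRing.Theory Num.Theory.
Local Open Scope ring_scope.

(* A two-element set of ends excludes loops. *)
Record multigraph := Multigraph {
  vertex :> finType;
  edge : finType;
  ends : edge -> {set vertex};
  card_ends : forall e, #|ends e| = 2%N }.

Definition multiplicity (G : multigraph) (x y : G) : nat :=
  #|[set e : edge G | ends e == [set x; y]]|.

Section IGraph.

Variable m : nat.

(* Vertices are numbered from 0, so k : 'I_(2m+1) stands for v_{k+1}.  Both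
   inl k and inr i denote an edge joining some vertex to its cyclic successor:
   inl k is the cycle edge v_{k+1} v_{k+2}, and inr i, for i < m, is the second
   copy of the edge v_{2i+1} v_{2i+2}. *)
Definition Igraph_tail (e : 'I_m.*2.+1 + 'I_m) : 'I_m.*2.+1 :=
  match e with
  | inl k => k
  | inr i => inord i.*2
  end.

Definition Igraph_ends (e : 'I_m.*2.+1 + 'I_m) : {set 'I_m.*2.+1} :=
  [set Igraph_tail e; ordS (Igraph_tail e)].

Lemma card_Igraph_ends (m_gt0 : (0 < m)%N) e : #|Igraph_ends e| = 2%N.
Proof.
rewrite /Igraph_ends cards2; set k := Igraph_tail e.
suff -> : k != ordS k by [].
rewrite -val_eqE /=; have := ltn_ord k; rewrite ltnS leq_eqVlt.
case/orP=> [/eqP -> | lt_k]; first by rewrite modnn double_eq0 -lt0n.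
by rewrite modn_small ?ltnS // neq_ltn ltnSn.
Qed.

(* For m = 0 the cycle would degenerate to a loop, hence the positivity proof. *)
Definition Igraph (m_gt0 : (0 < m)%N) : multigraph :=
  Multigraph (card_Igraph_ends m_gt0).

End IGraph.

Definition edges_between (T : finType) (adj : rel T) (X Y : {set T}) :
    {set {set T}} :=
  [set [set a; b] | a in X, b in Y & adj a b].

(* A matching is a set of pairwise disjoint edges.  The matchings of a family
   indexed by 'I_s may be empty or repeated, so this says "at most s". *)
Definition union_of_matchings (T : finType) (s : nat) (E : {set {set T}}) :
    Prop :=
  exists M : 'I_s -> {set {set T}},
    (forall i, trivIset (M i)) /\ E = \bigcup_i M i.

Record DP3cover (G : multigraph) := DP3Cover {
  cvertex : finType;
  cadj : rel cvertex;
  cadj_sym : symmetric cadj;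
  cadj_irr : irreflexive cadj;
  clist : G -> {set cvertex};
  clist_disjoint : forall x y, x != y -> [disjoint clist x & clist y];
  clist_cover : \bigcup_v clist v = [set: cvertex];
  card_clist : forall v, #|clist v| = 3%N;
  clist_clique : forall v, {in clist v &, forall a b, a != b -> cadj a b};
  cadj_matchings : forall x y, x != y ->
    union_of_matchings (multiplicity x y)
      (edges_between cadj (clist x) (clist y));
  basepoint : G -> cvertex;
  basepoint_in : forall v, basepoint v \in clist v }.

Definition potential_function (G : multigraph) (rho : G -> nat) : Prop :=
  forall v, rho v \in [:: 3; 4; 6]%N.

Definition hrho (G : multigraph) (rho : G -> nat) (v : G) : nat :=
  if rho v == 3%N then 2%N else 3%N.

Record dist (R : realType) (T : finType) := Dist {
  pmf :> {ffun T -> R};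
  pmf_ge0 : forall x, 0 <= pmf x;
  pmf_sum1 : \sum_x pmf x = 1 }.

Definition Pr (R : realType) (T : finType) (P : dist R T) (E : pred T) : R :=
  \sum_(x | E x) P x.

Section Joint.

Variables (R : realType) (S T : finType) (P : dist R S) (K : S -> dist R T).

Definition joint_pmf : {ffun S * T -> R} := [ffun p => P p.1 * K p.1 p.2].

Lemma joint_pmf_ge0 p : 0 <= joint_pmf p.
Proof. by rewrite ffunE mulr_ge0 ?pmf_ge0. Qed.

Lemma joint_pmf_sum1 : \sum_p joint_pmf p = 1.
Proof.
rewrite -(pmf_sum1 P) (eq_bigr (fun p => P p.1 * K p.1 p.2)); last first.
  by move=> p _; rewrite ffunE.
rewrite -(pair_bigA _ (fun s t => P s * K s t)) /=.
by apply: eq_bigr => s _; rewrite -mulr_sumr pmf_sum1 mulr1.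
Qed.

Definition joint : dist R (S * T)%type := Dist joint_pmf_ge0 joint_pmf_sum1.

End Joint.

Section Flexibility.

Variables (R : realType) (G : multigraph) (rho : G -> nat).

Section Cover.

Variable C : DP3cover G.

Local Notation lists := {ffun G -> {set cvertex C}}.
Local Notation colors := {ffun G -> cvertex C}.

Definition list_assignment (L' : lists) : Prop :=
  forall v, L' v \subset clist C v /\ #|L' v| = hrho rho v.

Definition independent (S : {set cvertex C}) : Prop :=
  {in S &, forall a b, ~~ cadj a b}.

Definition coloring (L' : lists) (phi : colors) : Prop :=
  (forall v, phi v \in L' v) /\ independent [set phi v | v : G].

Definition list_distribution (D : dist R lists) : Prop :=
  forall L', 0 < D L' -> list_assignment L'.

Definition admissible (eps : R) (D : dist R lists) : Prop :=
  forall v, hrho rho v = 2%N -> forall c, c \in clist C v ->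
    eps <= Pr D [pred L' : lists | clist C v :\: L' v == [set c]].

(* Only outcomes of positive probability are constrained: a list assignment of
   probability 0 need not have any coloring. *)
Definition coloring_distribution (D : dist R lists)
    (Phi : lists -> dist R colors) : Prop :=
  forall L', 0 < D L' -> forall phi, 0 < Phi L' phi -> coloring L' phi.

Definition color_prob (D : dist R lists) (Phi : lists -> dist R colors)
    (v : G) (c : cvertex C) : R :=
  Pr (joint D Phi) [pred p : lists * colors | p.2 v == c].

Definition eps_distribution (eps : R) (D : dist R lists)
    (Phi : lists -> dist R colors) : Prop :=
  coloring_distribution D Phi /\
  forall v,
    (forall c, c \in clist C v -> eps <= color_prob D Phi v c) /\
    (rho v = 4%N ->
       color_prob D Phi v (basepoint C v) = 2 * eps /\
       forall c, c \in clist C v :\ basepoint C v ->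
         color_prob D Phi v c = 1 / 2 - eps).

Definition flexible_for (eps : R) (D : dist R lists) : Prop :=
  exists Phi, eps_distribution eps D Phi.

End Cover.

Definition flexible (eps : R) : Prop :=
  forall (C : DP3cover G) (D : dist R {ffun G -> {set cvertex C}}),
    list_distribution D -> admissible eps D -> flexible_for eps D.

End Flexibility.

(* Main.v *)
Require Import Defs.
From mathcomp Require Import all_boot all_order all_algebra.
From mathcomp Require Import reals.

Set Implicit Arguments.
Unset Strict Implicit.

Import Order.TTheory GRing.Theory Num.Theory.
Local Open Scope ring_scope.

(* One cover of I_m defeats every potential function.  Its colors are None,
   Some false and Some true; single edges carry the identity matching, and
   double edges carry in addition the matching that exchanges Some false and
   Some true.  Suppose the last vertex v_{2m+1} gets color None.  Then v_1 does
   not; both Some colors of v_1 exclude both Some colors of v_2, so v_2 gets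
   None; hence v_3 does not, and so on around the cycle, until v_{2m} gets None,
   which conflicts with v_{2m+1}.  So None has probability 0 at v_{2m+1}. *)

(** * The twisted cover of a multigraph *)

Section TwistCover.

Variable G : multigraph.

(** Index 0 is the identity and every positive index is the same exchange, so the family serves any
    multiplicity; all its members fix [None]. *)
Definition twist (i : nat) : option bool -> option bool :=
  omap (addb (0 < i)%N).

Lemma twistK i : involutive (twist i).
Proof. by case=> [b|] //=; rewrite addKb. Qed.

Definition twist_adj : rel (G * option bool) := fun p q =>
  if p.1 == q.1 then p.2 != q.2
  else [exists i : 'I_(multiplicity p.1 q.1), q.2 == twist i p.2].

Lemma multiplicityC (x y : G) : multiplicity x y = multiplicity y x.
Proof. by rewrite /multiplicity setUC. Qed.

Lemma twist_adj_sym : symmetric twist_adj.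
Proof.
move=> [x a] [y b]; rewrite /twist_adj /= (eq_sym y) (eq_sym b).
case: eqP => // _; rewrite multiplicityC; apply: eq_existsb => i.
by rewrite -(inj_eq (can_inj (twistK i))) twistK.
Qed.

Lemma twist_adj_irr : irreflexive twist_adj.
Proof. by move=> p; rewrite /twist_adj !eqxx. Qed.

Definition twist_list (v : G) : {set G * option bool} := [set p | p.1 == v].

Lemma twist_listE v : twist_list v = [set (v, a) | a : option bool].
Proof.
apply/setP=> -[x a]; rewrite inE /=; apply/eqP/imsetP => [-> | [b _ [->]] //].
by exists a.
Qed.

Lemma twist_list_disjoint x y :
  x != y -> [disjoint twist_list x & twist_list y].
Proof.
move=> neq_xy; rewrite disjoint_subset; apply/subsetP=> p.
by rewrite !inE => /eqP->.
Qed.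

Lemma twist_list_cover : \bigcup_v twist_list v = [set: G * option bool].
Proof.
by apply/setP=> p; rewrite in_setT; apply/bigcupP; exists p.1; rewrite ?inE.
Qed.

Lemma card_twist_list v : #|twist_list v| = 3%N.
Proof.
rewrite twist_listE card_imset; last by move=> a b [].
by rewrite card_option card_bool.
Qed.

Lemma twist_list_clique v :
  {in twist_list v &, forall a b, a != b -> twist_adj a b}.
Proof.
move=> [x a] [y b]; rewrite !inE /= => /eqP-> /eqP->.
by rewrite /twist_adj /= eqxx xpair_eqE eqxx.
Qed.

Lemma twist_adj_matchings x y : x != y ->
  union_of_matchings (multiplicity x y)
    (edges_between twist_adj (twist_list x) (twist_list y)).
Proof.
move=> neq_xy.
(* The [i]-th matching is the graph of the bijection [twist i]: its edges are disjoint by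
   injectivity and [x != y]. *)
exists (fun i => [set [set (x, a); (y, twist i a)] | a : option bool]).
split=> [i|].
  apply/trivIsetP=> _ _ /imsetP[a _ ->] /imsetP[b _ ->] neq_ab.
  have {}neq_ab : a != b by apply: contraNneq neq_ab => ->.
  rewrite -setI_eq0; apply/eqP/setP=> p; rewrite !inE.
  apply/negP=> /andP[/orP[]/eqP-> /orP[]]; rewrite xpair_eqE => /andP[].
  - by rewrite (negPf neq_ab).
  - by rewrite (negPf neq_xy).
  - by rewrite eq_sym (negPf neq_xy).
  - by rewrite (inj_eq (can_inj (twistK i))) (negPf neq_ab).
apply/setP=> E; apply/imset2P/bigcupP.
- case=> [[x' a] [y' b]]; rewrite !inE /= => /eqP->.
  rewrite /twist_adj /= => /andP[/eqP->].
  rewrite (negPf neq_xy) => /existsP[i /eqP->] ->.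
  by exists i => //; apply/imsetP; exists a.
case=> i _ /imsetP[a _ ->].
apply: (Imset2spec (x1 := (x, a)) (x2 := (y, twist i a))); rewrite ?inE //=.
by rewrite eqxx /twist_adj /= (negPf neq_xy); apply/existsP; exists i.
Qed.

Definition twist_basepoint (v : G) : G * option bool := (v, None).

Lemma twist_basepoint_in v : twist_basepoint v \in twist_list v.
Proof. by rewrite inE. Qed.

Definition twist_cover : DP3cover G :=
  DP3Cover twist_adj_sym twist_adj_irr twist_list_disjoint twist_list_cover
    card_twist_list twist_list_clique twist_adj_matchings twist_basepoint_in.

End TwistCover.

(** * An admissible list distribution *)

Section UniformDeletion.

Variables (R : realType) (G : multigraph) (rho : G -> nat).

Local Notation lists := {ffun G -> {set cvertex (twist_cover G)}}.

(** The same color is deleted at all vertices with [rho v = 3] at once, so three outcomes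
    suffice. *)
Definition deletion_lists (c : option bool) : lists :=
  [ffun v => if rho v == 3%N then twist_list v :\ (v, c) else twist_list v].

Lemma deletion_lists_assignment c : list_assignment rho (deletion_lists c).
Proof.
move=> v; rewrite ffunE /hrho /=; case: ifP => _; last first.
  by rewrite subxx card_twist_list.
split; first exact: subsetDl.
have := card_twist_list v.
by rewrite (cardsD1 (v, c)) inE eqxx add1n => -[].
Qed.

(** A sum of point masses has total mass 1 even when the three outcomes coincide, as they do if
    [rho] never takes the value 3. *)
Definition deletion_pmf : {ffun lists -> R} :=
  [ffun L' => \sum_c (3%:R^-1 * (L' == deletion_lists c)%:R)].

Lemma deletion_pmf_ge0 L' : 0 <= deletion_pmf L'.
Proof.
by rewrite ffunE sumr_ge0 // => c _; rewrite mulr_ge0 ?invr_ge0 ?ler0n.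
Qed.

Lemma deletion_pmf_sum1 : \sum_L' deletion_pmf L' = 1.
Proof.
under eq_bigr do rewrite ffunE; rewrite exchange_big /=.
rewrite (eq_bigr (fun=> 3%:R^-1)) => [|c _].
  by rewrite sumr_const card_option card_bool -[_ *+ _]mulr_natl divff ?pnatr_eq0.
rewrite -mulr_sumr (bigD1 (deletion_lists c)) //= eqxx big1 ?addr0 ?mulr1 //.
by move=> L' /negPf->.
Qed.

Definition deletion_dist : dist R lists :=
  Dist deletion_pmf_ge0 deletion_pmf_sum1.

Lemma deletion_dist_lists : list_distribution rho deletion_dist.
Proof.
move=> L'; have [c /eqP-> _ |noc] := pickP (fun c => L' == deletion_lists c).
  exact: deletion_lists_assignment.
by rewrite /= ffunE big1 ?ltxx // => c _; rewrite noc mulr0.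
Qed.

Lemma deletion_dist_ge c : 3%:R^-1 <= deletion_dist (deletion_lists c).
Proof.
rewrite /= ffunE (bigD1 c) //= eqxx mulr1 lerDl.
by rewrite sumr_ge0 // => d _; rewrite mulr_ge0 ?invr_ge0 ?ler0n.
Qed.

(** At a vertex with [rho v = 3] the three deletion events are disjoint, so [1 / 3] is the largest
    bound that any distribution can meet; the uniform choice meets it. *)
Lemma deletion_dist_admissible (eps : R) :
  ((exists v, rho v = 3%N) -> eps <= 1 / 3) ->
  admissible rho eps deletion_dist.
Proof.
move=> eps_le v; rewrite /hrho; case: eqP => // rho_v _ [x a].
rewrite inE /= => /eqP->.
have /le_trans : eps <= 3%:R^-1 by rewrite -div1r; apply: eps_le; exists v.
apply; apply: le_trans (deletion_dist_ge a) _; rewrite /Pr.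
rewrite (bigD1 (deletion_lists a)); last first.
  rewrite /= ffunE rho_v eqxx setDDr setDv set0U; apply/eqP/setIidPr.
  by rewrite sub1set inE.
by rewrite lerDl sumr_ge0 // => L' _; exact: pmf_ge0.
Qed.

End UniformDeletion.

(** A pair with color [c] at [v] cannot have both factors of its joint mass positive, so each term
    of the sum vanishes. *)
Lemma color_prob_eq0 (R : realType) (G : multigraph) (C : DP3cover G)
    (D : dist R {ffun G -> {set cvertex C}})
    (Phi : {ffun G -> {set cvertex C}} -> dist R {ffun G -> cvertex C})
    (v : G) (c : cvertex C) :
  coloring_distribution D Phi ->
  (forall L' phi, 0 < D L' -> coloring L' phi -> phi v != c) ->
  color_prob D Phi v c = 0.
Proof.
move=> colPhi no_c; rewrite /color_prob /Pr big1 // => -[L' phi] /= phi_v.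
rewrite ffunE /=; have := pmf_ge0 D L'; rewrite le_eqVlt => /predU1P[<-|D_gt0].
  by rewrite mul0r.
have := pmf_ge0 (Phi L') phi.
rewrite le_eqVlt => /predU1P[<-|Phi_gt0]; first by rewrite mulr0.
by have := no_c _ _ D_gt0 (colPhi _ D_gt0 _ Phi_gt0); rewrite phi_v.
Qed.

(** * Propagation of [None] along edges *)

Section TwistColoring.

Variables (G : multigraph) (L' : {ffun G -> {set cvertex (twist_cover G)}}).
Variable phi : {ffun G -> cvertex (twist_cover G)}.
Hypothesis L'sub : forall v, L' v \subset clist (twist_cover G) v.
Hypothesis phi_col : coloring L' phi.

Lemma coloring_fst v : (phi v).1 = v.
Proof.
by have [/(_ v) /(subsetP (L'sub v))] := phi_col; rewrite inE => /eqP.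
Qed.

Lemma coloring_twist x y (i : 'I_(multiplicity x y)) :
  x != y -> (phi y).2 != twist i (phi x).2.
Proof.
move=> neq_xy; have [_ ind] := phi_col.
have := ind _ _ (imset_f phi (isT : x \in G)) (imset_f phi (isT : y \in G)).
rewrite /= /twist_adj !coloring_fst (negPf neq_xy).
by rewrite negb_exists => /forallP.
Qed.

Lemma coloring_edge {x y} :
  x != y -> (0 < multiplicity x y)%N -> (phi x).2 = None -> (phi y).2 != None.
Proof.
move=> neq_xy mul_gt0 phi_x.
by have := coloring_twist (Ordinal mul_gt0) neq_xy; rewrite phi_x.
Qed.

Lemma coloring_double_edge {x y} :
  x != y -> (1 < multiplicity x y)%N -> (phi x).2 != None -> (phi y).2 = None.
Proof.
move=> neq_xy mul_gt1.
(* Indices 0 and 1: the identity and the exchange together exclude both [Some] colors at [y]. *)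
have := coloring_twist (Ordinal (ltnW mul_gt1)) neq_xy.
have := coloring_twist (Ordinal mul_gt1) neq_xy.
by case: (phi x).2 (phi y).2 => [[]|] // [[]|].
Qed.

End TwistColoring.

(** * Going around the cycle of [Igraph] *)

Section IgraphColoring.

Variables (m : nat) (m_gt0 : (0 < m)%N).

Local Notation I := (Igraph m_gt0).

Lemma Igraph_multiplicity_gt0 (k : 'I_m.*2.+1) :
  (0 < multiplicity (k : I) (ordS k))%N.
Proof. by apply/card_gt0P; exists (inl k); rewrite inE. Qed.

Lemma Igraph_multiplicity_gt1 i : (i < m)%N ->
  (1 < multiplicity (inord i.*2 : I) (ordS (inord i.*2)))%N.
Proof.
move=> lt_im; apply/card_gt1P.
by exists (inl (inord i.*2)), (inr (Ordinal lt_im)); rewrite !inE.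
Qed.

(** Both are the ends of the edge [inl k], and loops are excluded. *)
Lemma ordS_neq (k : 'I_m.*2.+1) : k != ordS k.
Proof. by have := card_ends (inl k : edge I); rewrite cards2; case: eqP. Qed.

Lemma ordS_inord k : (k < m.*2)%N ->
  ordS (inord k) = inord k.+1 :> 'I_m.*2.+1.
Proof.
move=> lt_k; apply: val_inj.
by rewrite /= !inordK ?ltnS ?modn_small // ltnW.
Qed.

Lemma Igraph_last_color (L' : {ffun I -> {set cvertex (twist_cover I)}})
    (phi : {ffun I -> cvertex (twist_cover I)}) :
    (forall v, L' v \subset clist (twist_cover I) v) -> coloring L' phi ->
  phi ord_max != (ord_max, None).
Proof.
move=> L'sub phi_col; apply/eqP=> phi_max.
have single (k : 'I_m.*2.+1) : (phi k).2 = None -> (phi (ordS k)).2 != None.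
  apply: coloring_edge L'sub phi_col _ _ (ordS_neq k) _.
  exact: Igraph_multiplicity_gt0.
(* Counting from 0, the double edge from [2i] forces [None] at [2i+1], and the next cycle edge then
   forbids it at [2i+2]. *)
have even_color i : (i <= m)%N -> (phi (inord i.*2)).2 != None.
  elim: i => [_|i IHi lt_im].
    (* The base case uses the edge that closes the cycle. *)
    suff -> : inord 0.*2 = ordS ord_max :> 'I_m.*2.+1.
      by apply: single; rewrite phi_max.
    by apply: val_inj; rewrite /= inordK // modnn.
  have lt_2i : (i.*2.+1 < m.*2)%N by rewrite -doubleS leq_double.
  rewrite doubleS -ordS_inord //; apply: single.
  rewrite -ordS_inord ?(ltnW lt_2i) //.
  apply: coloring_double_edge L'sub phi_col _ _ (ordS_neq _) _ (IHi (ltnW lt_im)).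
  exact: Igraph_multiplicity_gt1.
(* Index [2m] is the last vertex itself, which was assumed to have color [None]. *)
have := even_color m (leqnn m).
suff -> : inord m.*2 = ord_max :> 'I_m.*2.+1 by rewrite phi_max.
by apply: val_inj; rewrite /= inordK.
Qed.

End IgraphColoring.

Unset Implicit Arguments.
Set Strict Implicit.

Theorem mainTheorem4 (R : realType) (m : nat) (m_gt0 : (0 < m)%N) (eps : R)
    (rho : Igraph m_gt0 -> nat) :
  0 < eps -> potential_function rho ->
  ((exists v, rho v = 3%N) -> eps <= 1 / 3) ->
  ~ flexible rho eps.
Proof.
move=> eps_gt0 _ eps_le flex.
have [Phi [colPhi /(_ ord_max) [color_ge _]]] :=
  flex _ _ (@deletion_dist_lists R _ rho) (deletion_dist_admissible eps_le).
(* The basepoint of the last vertex is its color [None], so condition (i) would give [eps <= 0]. *)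
have := color_ge _ (twist_basepoint_in _); rewrite color_prob_eq0 //.
  by rewrite leNgt eps_gt0.
move=> L' phi D_gt0; apply: Igraph_last_color => v.
by have [] := deletion_dist_lists D_gt0 v.
Qed.
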